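(* Let $X$ be a directed space. Then $(UX, O_{\Rightarrow_U}(UX))$, with the binary operation $\uparrow F_1\cup\uparrow F_2=\uparrow(F_1\cup F_2)$, is the directed upper powerspace over $X$; that is, with $UX$ endowed with the topology $O_{\Rightarrow_U}(UX)$, $(UX,\cup)\cong P_U(X)$.
   Context: All topological spaces are $T_0$. For a $T_0$ space $X$ with topology $O(X)$, the specialization order is $x\sqsubseteq y \iff x\in\overline{\{y\}}$; all order-theoretic notions on a space refer to it (also written $\le$). For $A\subseteq X$, $\uparrow A=\{x:\exists a\in A,\ a\sqsubseteq x\}$, $\downarrow A=\{x:\exists a\in A,\ x\sqsubseteq a\}$. A directed set is a nonempty subset in which every nonempty finite subset has an upper bound. A directed set $D\subseteq X$, viewed as a net indexed by itself, converges to $x$, written $D\to x$, if it is eventually in every open neighbourhood of $x$; $\lim D$ denotes the set of all $x$ with $D\to x$. A subset $U\subseteq X$ is directed open if for every directed $D\subseteq X$ and $x\in U$ with $D\to x$ one has $D\cap U\ne\emptyset$; $d(X)$ is the family of directed open sets. $X$ is a directed space if it is $T_0$ and $d(X)=O(X)$. For directed spaces $X,Y$, $X\otimes Y$ is the set $X\times Y$ with the topology in which $U$ is open iff for every pointwise-directed $D\subseteq X\times Y$ and $(x,y)\in U$ with $\pi_1D\to x$ in $X$ and $\pi_2D\to y$ in $Y$ one has $U\cap D\ne\emptyset$. A directed deflationary semilattice is a directed space $X$ with a continuous operation $\oplus:X\otimes X\to X$ that is idempotent, associative, commutative and satisfies $x\oplus y\le x$ for all $x,y$ (such an operation is necessarily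 the binary meet $\wedge$ for the specialization order). A deflationary homomorphism is a continuous map preserving the operation. A directed space $Z$ is the directed upper powerspace over $X$ (denoted $P_U(X)$; it is unique up to a homeomorphism that is also a deflationary homomorphism) iff: (1) $Z$ is a directed deflationary semilattice $(Z,\wedge)$; (2) there is a continuous $i:X\to Z$ such that for every directed deflationary semilattice $(Y,\wedge)$ and every continuous $f:X\to Y$ there is a unique deflationary homomorphism $\bar f:(Z,\wedge)\to(Y,\wedge)$ with $f=\bar f\circ i$. $UX=\{\uparrow F: F \text{ a nonempty finite subset of } X\}$, ordered by $\uparrow F_1\le_U\uparrow F_2\iff \uparrow F_2\subseteq\uparrow F_1$. For a $\le_U$-directed $\mathcal F\subseteq UX$ and $\uparrow F\in UX$, $\mathcal F\Rightarrow_U\uparrow F$ means: there are finitely many directed sets $D_1,\dots,D_n\subseteq X$ such that (i) $F\cap\lim D_i\neq\emptyset$ for every $i$; (ii) $F\subseteq\bigcup_{i=1}^n\lim D_i$; (iii) for every $(d_1,\dots,d_n)\in\prod_{i=1}^nD_i$ there is $\uparrow F'\in\mathcal F$ with $\uparrow F'\subseteq\bigcup_{i=1}^n\uparrow d_i$. $O_{\Rightarrow_U}(UX)$ is the family of all $\mathcal U\subseteq UX$ such that for every directed $\mathcal F\subseteq UX$ and $\uparrow F\in UX$, $\mathcal F\Rightarrow_U\uparrow F\in\mathcal U$ implies $\mathcal F\cap\mathcal U\ne\emptyset$. *)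

(* Defs.v *)
From HB Require Import structures.
From mathcomp Require Import all_boot.
From mathcomp Require Import boolp classical_sets cardinality topology.

Set Implicit Arguments.
Unset Strict Implicit.
Unset Printing Implicit Defensive.

Local Open Scope classical_set_scope.

Definition directed_set (T : Type) (le : T -> T -> Prop) (D : set T) : Prop :=
  D !=set0 /\
  forall F : set T, finite_set F -> F !=set0 -> F `<=` D ->
    exists2 u, D u & forall x, F x -> le x u.

Lemma directed_set1 (T : Type) (le : T -> T -> Prop) (x : T) :
  le x x -> directed_set le [set x].
Proof.
move=> lexx; split; first by exists x.
by move=> F _ _ FD; exists x => // y /FD ->.
Qed.

Lemma directed_set2 (T : Type) (le : T -> T -> Prop) (D : set T) (x y : T) :
  directed_set le D -> D x -> D y -> exists u, [/\ D u, le x u & le y u].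
Proof.
move=> [_ dirD] Dx Dy.
have [|||u Du leu] := dirD [set x; y].
- exact: finite_set2.
- by exists x; left.
- by move=> z [] ->.
by exists u; split=> //; apply: leu; [left|right].
Qed.

Section SpecializationOrder.
Variable X : topologicalType.
Implicit Types (x y : X) (A D U : set X).

Definition spec_le x y : Prop := closure [set y] x.

Definition up_set A : set X := [set x | exists2 a, A a & spec_le a x].

(* Convergence of D seen as a net indexed by itself; it is only used for
   directed D. *)
Definition dcvg D x : Prop :=
  forall U, open U -> U x ->
    exists2 d0, D d0 & forall d, D d -> spec_le d0 d -> U d.

Definition dlim D : set X := [set x | dcvg D x].

Definition directed_open U : Prop :=
  forall D x, directed_set spec_le D -> U x -> dcvg D x -> (D `&` U) !=set0.

Definition directed_space : Prop :=
  kolmogorov_space X /\ directed_open = @open X.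

Lemma spec_leP x y : spec_le x y <-> forall U, open U -> U x -> U y.
Proof.
split=> [xy U oU Ux|h B].
  have /xy[z [-> //]] : nbhs x U by exact: open_nbhs_nbhs.
rewrite nbhsE => -[U [oU Ux] UB]; exists y; split=> //.
by apply: UB; exact: h Ux.
Qed.

Lemma spec_le_refl x : spec_le x x.
Proof. exact/spec_leP. Qed.

Lemma spec_le_trans x y z : spec_le x y -> spec_le y z -> spec_le x z.
Proof. by move=> /spec_leP xy /spec_leP yz; apply/spec_leP => U oU /xy /yz; auto. Qed.

Lemma dcvg_set1 x y : spec_le x y -> dcvg [set y] x.
Proof.
by move=> /spec_leP xy U oU Ux; exists y => // _ -> _; exact: xy Ux.
Qed.

Lemma up_setU A B : up_set (A `|` B) = up_set A `|` up_set B.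
Proof.
apply/seteqP; split=> x /=.
  by case=> a [Aa|Ba] ax; [left|right]; exists a.
by case=> -[a Aa ax]; exists a => //; [left|right].
Qed.

End SpecializationOrder.
Arguments directed_space : clear implicits.

(* The carrier of X \otimes Y; the alias keeps its topology apart from the
   product topology carried by X * Y. *)
Definition dprod (X Y : topologicalType) : Type := (X * Y)%type.

Section DirectedProduct.
Variables X Y : topologicalType.

HB.instance Definition _ := Choice.copy (dprod X Y) (X * Y)%type.

Definition dprod_le (p q : dprod X Y) : Prop :=
  spec_le p.1 q.1 /\ spec_le p.2 q.2.

Definition dprod_open (U : set (dprod X Y)) : Prop :=
  forall (D : set (dprod X Y)) (x : X) (y : Y),
    directed_set dprod_le D -> U (x, y) ->
    dcvg [set p.1 | p in D] x -> dcvg [set p.2 | p in D] y ->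
    (U `&` D) !=set0.

Lemma dprod_open_up (U : set (dprod X Y)) (p q : dprod X Y) :
  dprod_open U -> U p -> dprod_le p q -> U q.
Proof.
case: p => x y oU Up [/= le1 le2].
have [||||z [Uz qz]] := oU [set q] x y.
- by apply: directed_set1; split; exact: spec_le_refl.
- exact: Up.
- by rewrite image_set1; exact: dcvg_set1.
- by rewrite image_set1; exact: dcvg_set1.
by rewrite -qz.
Qed.

Let dprod_openT : dprod_open setT.
Proof. by move=> D x y [[d Dd] _] _ _ _; exists d. Qed.

Let dprod_openI : setI_closed dprod_open.
Proof.
move=> U V oU oV D x y dirD [Ux Vx] cx cy.
have [p [Up Dp]] := oU D x y dirD Ux cx cy.
have [q [Vq Dq]] := oV D x y dirD Vx cx cy.
have [u [Du pu qu]] := directed_set2 dirD Dp Dq.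
by exists u; split=> //; split; [exact: dprod_open_up pu|exact: dprod_open_up qu].
Qed.

Let dprod_open_bigU (I : Type) (f : I -> set (dprod X Y)) :
  (forall i, dprod_open (f i)) -> dprod_open (\bigcup_i f i).
Proof.
move=> of_ D x y dirD [i _ fi] cx cy.
by have [p [fp Dp]] := of_ i D x y dirD fi cx cy; exists p; split=> //; exists i.
Qed.

HB.instance Definition _ :=
  isOpenTopological.Build (dprod X Y) dprod_openT dprod_openI dprod_open_bigU.

Lemma open_dprodE : @open (dprod X Y) = dprod_open.
Proof. by []. Qed.

End DirectedProduct.

Definition directed_deflationary_semilattice
    (X : topologicalType) (op : X -> X -> X) : Prop :=
  [/\ directed_space X,
      continuous (fun p : dprod X X => op p.1 p.2),
      idempotent_op op /\ associative op,
      commutative op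
    & forall x y, spec_le (op x y) x].

Definition deflationary_hom (X Y : topologicalType)
    (opX : X -> X -> X) (opY : Y -> Y -> Y) (f : X -> Y) : Prop :=
  continuous f /\ {morph f : x y / opX x y >-> opY x y}.

Definition deflationary_iso (X Y : topologicalType)
    (opX : X -> X -> X) (opY : Y -> Y -> Y) : Prop :=
  exists (f : X -> Y) (g : Y -> X),
    [/\ cancel f g, cancel g f, continuous g & deflationary_hom opX opY f].

Definition directed_upper_powerspace
    (X Z : topologicalType) (meetZ : Z -> Z -> Z) : Prop :=
  directed_deflationary_semilattice meetZ /\
  exists2 i : X -> Z, continuous i &
    forall (Y : topologicalType) (meetY : Y -> Y -> Y),
      directed_deflationary_semilattice meetY ->
      forall f : X -> Y, continuous f ->
        exists! fbar : Z -> Y,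
          deflationary_hom meetZ meetY fbar /\ f = fbar \o i.
Arguments directed_upper_powerspace X {Z} meetZ.

Definition nonempty_finite (X : Type) : set (set X) :=
  [set F | finite_set F /\ F !=set0].

Definition finite_upper (X : topologicalType) : set (set X) :=
  [set up_set F | F in @nonempty_finite X].
Arguments finite_upper : clear implicits.

(* UX; the alias keeps its topology apart from the initial topology that
   set_type carries. *)
Definition upper_space (X : topologicalType) : Type := set_type (finite_upper X).

Section UpperSpace.
Variable X : topologicalType.
Local Notation UX := (upper_space X).

HB.instance Definition _ := gen_eqMixin UX.
HB.instance Definition _ := gen_choiceMixin UX.

Definition upper_carrier (A : UX) : set X := sval A.

Definition upper_le (A B : UX) : Prop := upper_carrier B `<=` upper_carrier A.

(* The relation is stated on the generating set F; it does not depend on the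
   choice of F, since the singletons of another generating set may be added to
   the D i. *)
Definition upper_cvg (FF : set UX) (F : set X) : Prop :=
  exists (n : nat) (D : 'I_n -> set X),
    [/\ forall i, directed_set (@spec_le X) (D i),
        forall i, (F `&` dlim (D i)) !=set0,
        F `<=` \bigcup_i dlim (D i)
      & forall d : 'I_n -> X, (forall i, D i (d i)) ->
          exists2 A, FF A & upper_carrier A `<=` \bigcup_i up_set [set d i]].

Definition upper_open (UU : set UX) : Prop :=
  forall (FF : set UX) (F : set X) (A : UX),
    directed_set upper_le FF -> nonempty_finite F -> upper_carrier A = up_set F ->
    upper_cvg FF F -> UU A -> (FF `&` UU) !=set0.

Lemma upper_open_up (UU : set UX) (A B : UX) :
  upper_open UU -> UU A -> upper_le A B -> UU B.
Proof.
move=> oU UA AB.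
have [F [finF F0] FA] := set_mem (valP A).
suff cB : upper_cvg [set B] F.
  have dB : directed_set upper_le [set B] by apply: directed_set1 => ?; apply.
  by have [C [/= ->]] := oU _ F A dB (conj finF F0) (esym FA) cB UA.
have [s Fs] := (finite_seqP F).1 finF.
have sF x : x \in s -> F x by rewrite Fs.
case: s Fs sF => [Fs _|x0 s Fs sF].
  by case: F0 => x; rewrite Fs.
exists (size (x0 :: s)), (fun i => [set nth x0 (x0 :: s) i]); split.
- by move=> i; apply: directed_set1; exact: spec_le_refl.
- move=> i; exists (nth x0 (x0 :: s) i); split.
    by apply: sF; exact: mem_nth.
  by apply: dcvg_set1; exact: spec_le_refl.
- move=> x; rewrite Fs /= => xs.
  have xi : (index x (x0 :: s) < size (x0 :: s))%N by rewrite index_mem.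
  exists (Ordinal xi) => //; apply: dcvg_set1 => /=.
  by rewrite -[X in spec_le x X]/(nth x0 (x0 :: s) (index x (x0 :: s))) nth_index //; exact: spec_le_refl.
- move=> d dE; exists B => // x /AB; rewrite /upper_carrier -FA => -[a].
  rewrite Fs /= => as_ ax.
  have ai : (index a (x0 :: s) < size (x0 :: s))%N by rewrite index_mem.
  exists (Ordinal ai) => //; exists a => //=.
  by rewrite (dE (Ordinal ai)) -[RHS]/(nth x0 (x0 :: s) (index a (x0 :: s))) nth_index.
Qed.

Let upper_openT : upper_open setT.
Proof. by move=> FF F A [[B FB] _] *; exists B. Qed.

Let upper_openI : setI_closed upper_open.
Proof.
move=> U V oU oV FF F A dF fF AE cF [UA VA].
have [P [FP UP]] := oU FF F A dF fF AE cF UA.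
have [Q [FQ VQ]] := oV FF F A dF fF AE cF VA.
have [R [FR PR QR]] := directed_set2 dF FP FQ.
by exists R; split=> //; split; [exact: upper_open_up PR|exact: upper_open_up QR].
Qed.

Let upper_open_bigU (I : Type) (f : I -> set UX) :
  (forall i, upper_open (f i)) -> upper_open (\bigcup_i f i).
Proof.
move=> of_ FF F A dF fF AE cF [i _ fi].
by have [P [FP fP]] := of_ i FF F A dF fF AE cF fi; exists P; split=> //; exists i.
Qed.

HB.instance Definition _ :=
  isOpenTopological.Build UX upper_openT upper_openI upper_open_bigU.

Lemma open_upperE : @open UX = upper_open.
Proof. by []. Qed.

Lemma finite_upperU (A B : UX) :
  finite_upper X (upper_carrier A `|` upper_carrier B).
Proof.
have [F [finF [x Fx]] FA] := set_mem (valP A).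
have [G [finG _] GB] := set_mem (valP B).
exists (F `|` G); last by rewrite up_setU FA GB.
by split; [rewrite finite_setU|exists x; left].
Qed.

Definition upper_union (A B : UX) : UX :=
  exist _ (upper_carrier A `|` upper_carrier B) (mem_set (finite_upperU A B)).

End UpperSpace.
Arguments upper_union : clear implicits.

(* Main.v *)
Require Import Defs.
From mathcomp Require Import all_boot.
From mathcomp Require Import boolp classical_sets cardinality topology.

(** The finitely generated upper sets of [X], ordered by reverse inclusion,
    form the free semilattice over the points [up x], and the extension of
    [f : X -> Y] to them sends [up F] to the infimum of [f F]. What has to be
    proved is that the topology makes everything continuous.

    The opens of [UX] are the sets that catch every directed family converging,
    in the combinatorial sense, to one of their elements. Such a family also
    converges topologically, so the topology is determined by its directed
    convergence. For [U] open in [X] the sets [{A | A `<=` U}] are open, and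
    they force the specialization order to be reverse inclusion; hence [UX] is a
    directed space ([upper_directed_space]).

    Continuity on a directed product can be checked one variable at a time
    ([continuous_dprod]). As [up F] is a finite union of points, continuity of
    the union therefore reduces to adding one point to a converging family
    ([continuous_upper_union_point]).

    For the extension of [f], let directed sets [D_1, ..., D_n] witness that a
    family converges to [F], and put [m = inf f F]. Every [D_i] has a limit in
    [F], and the set of limits of a net is downward closed, so every [f D_i]
    converges to [m] itself. Since [m] is idempotent, continuity of the meet
    allows to replace the factors of [m = inf (m, ..., m)] one at a time by
    elements of the [f D_i] without leaving a given neighbourhood of [m]
    ([ddsl_dcvg_lower_bound]); this is continuity of the extension
    ([continuous_upper_inf]). Homomorphisms are determined by their values on
    the points, because unions generate the rest ([upper_space_ind]). A
    universal object is unique up to isomorphism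
    ([directed_upper_powerspace_uniq]), which gives the second claim. *)

Set Implicit Arguments.
Unset Strict Implicit.
Unset Printing Implicit Defensive.

Local Open Scope classical_set_scope.

(** * Directed sets and their limits *)

Lemma directed_set_pairs (T : choiceType) (le : T -> T -> Prop) (D : set T) :
  (forall x y z, le x y -> le y z -> le x z) ->
  D !=set0 ->
  (forall x y, D x -> D y -> exists u, [/\ D u, le x u & le y u]) ->
  directed_set le D.
Proof.
move=> le_trans [d Dd] ub2; split; first by exists d.
move=> F /finite_seqP[s ->] _ {F}; elim: s => [|x s IHs] sD; first by exists d.
have [|u Du leu] := IHs.
  by move=> y ys; apply: sD; rewrite /= inE; apply/orP; right.
have [|v [Dv xv uv]] := ub2 x u _ Du; first by apply: sD; exact: mem_head.
exists v => // y; rewrite /= inE => /orP[/eqP-> //|/leu yu].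
exact: le_trans yu uv.
Qed.

Lemma directed_set_image (T : Type) (T' : choiceType) (le : T -> T -> Prop)
    (le' : T' -> T' -> Prop) (g : T -> T') (D : set T) :
  (forall x y z, le' x y -> le' y z -> le' x z) ->
  (forall x y, le x y -> le' (g x) (g y)) ->
  directed_set le D -> directed_set le' [set g x | x in D].
Proof.
move=> le'_trans gmono dirD; apply: directed_set_pairs => //.
  by have [d Dd] := dirD.1; exists (g d), d.
move=> _ _ [x Dx <-] [y Dy <-].
have [u [Du xu yu]] := directed_set2 dirD Dx Dy.
by exists (g u); split; [exists u|exact: gmono|exact: gmono].
Qed.

Section Convergence.
Variable X : topologicalType.
Implicit Types (x y : X) (D U : set X).

(** Open sets are upward closed, so a directed set that meets one stays in it
    from there on; convergence thus never needs the tails of the net. *)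
Lemma dcvgP D x :
  dcvg D x <-> forall U, open U -> U x -> exists2 d, D d & U d.
Proof.
split=> [Dx U oU Ux|Dx U oU Ux].
  by have [d Dd Ud] := Dx U oU Ux; exists d => //; apply: Ud => //; exact: spec_le_refl.
have [d Dd Ud] := Dx U oU Ux.
by exists d => // e _ /spec_leP/(_ U oU Ud).
Qed.

Lemma dcvg_le D x y : spec_le x y -> dcvg D y -> dcvg D x.
Proof. by move=> /spec_leP xy /dcvgP Dy; apply/dcvgP => U oU /(xy U oU); exact: Dy. Qed.

Lemma kolmogorov_spec_le_anti x y :
  kolmogorov_space X -> spec_le x y -> spec_le y x -> x = y.
Proof.
move=> T0 /spec_leP xy /spec_leP yx; apply/eqP/negP => /negP /T0 [A].
have sep u v : (forall U, open U -> U u -> U v) -> A \in nbhs u -> ~ v \in ~` A.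
  rewrite !inE nbhsE => uv [U [oU Uu] UA]; apply; apply: UA.
  exact: uv Uu.
by move=> [[/(sep _ _ xy)]|[/(sep _ _ yx)]].
Qed.

Lemma spec_le_anti_kolmogorov :
  (forall x y, spec_le x y -> spec_le y x -> x = y) -> kolmogorov_space X.
Proof.
move=> anti x y /eqP xNy.
have sep u v : ~ spec_le u v -> exists A : set X, A \in nbhs u /\ v \in ~` A.
  move=> /spec_leP/existsNP[U /not_implyP[oU /not_implyP[Uu nUv]]].
  by exists U; rewrite !inE; split=> //; exact: open_nbhs_nbhs.
have [xy|/sep[A ?]] := pselect (spec_le x y); last by exists A; left.
have [yx|/sep[A ?]] := pselect (spec_le y x); last by exists A; right.
by case: xNy; exact: anti.
Qed.

Lemma open_directed_open U : open U -> directed_open U.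
Proof. by move=> oU D x _ Ux /dcvgP/(_ U oU Ux)[d Dd Ud]; exists d. Qed.

(** Antisymmetry of the specialization order is the form in which the separation
    axiom is used, and only one inclusion between the topologies has content. *)
Lemma directed_spaceP :
  directed_space X <->
  (forall x y, spec_le x y -> spec_le y x -> x = y) /\
  (forall U, directed_open U -> open U).
Proof.
split=> [[T0 dE]|[anti dO]].
  split=> [x y|U]; first exact: kolmogorov_spec_le_anti.
  by rewrite -dE.
split; first exact: spec_le_anti_kolmogorov.
by apply/funext => U; apply/propext; split; [exact: dO|exact: open_directed_open].
Qed.

End Convergence.

Lemma continuous_open (X Y : topologicalType) (f : X -> Y) (U : set Y) :
  continuous f -> open U -> open (f @^-1` U).
Proof. by move=> /continuousP cf; exact: cf. Qed.

Section ContinuousMaps.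
Variables (X Y : topologicalType) (f : X -> Y).
Hypothesis cf : continuous f.

Lemma continuous_spec_le x y : spec_le x y -> spec_le (f x) (f y).
Proof.
move=> /spec_leP xy; apply/spec_leP => U oU.
by apply: (xy (f @^-1` U)); exact: continuous_open.
Qed.

Lemma continuous_dcvg D x : dcvg D x -> dcvg [set f d | d in D] (f x).
Proof.
move=> /dcvgP Dx; apply/dcvgP => U oU Ufx.
have [|d Dd Ud] := Dx (f @^-1` U) _ Ufx; first exact: continuous_open.
by exists (f d) => //; exists d.
Qed.

End ContinuousMaps.

(** * Separate continuity and deflationary semilattices *)

(** A directed family of pairs dominates any combination of two of its
    coordinates, so the two coordinates may be moved one after the other. This
    is what the topology of the directed product has over the usual product
    topology. *)
Lemma continuous_dprod (X Y Z : topologicalType) (h : X -> Y -> Z) :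
  (forall y, continuous (h^~ y)) -> (forall x, continuous (h x)) ->
  continuous (fun p : dprod X Y => h p.1 p.2).
Proof.
move=> hl hr; apply/continuousP => U oU.
rewrite open_dprodE => D x y dirD /= Uxy /dcvgP Dx /dcvgP Dy.
have [|_ [p Dp <-] Upy] := Dx ((h^~ y) @^-1` U) _ Uxy.
  exact: continuous_open (hl y) oU.
have [|_ [q Dq <-] Upq] := Dy (h p.1 @^-1` U) _ Upy.
  exact: continuous_open (hr p.1) oU.
have [u [Du [pu1 _] [_ qu2]]] := directed_set2 dirD Dp Dq.
exists u; split=> //=.
move/spec_leP: (continuous_spec_le (hr p.1) qu2) => /(_ U oU Upq) Upu.
by move/spec_leP: (continuous_spec_le (hl u.2) pu1) => /(_ U oU Upu).
Qed.

Section DeflationarySemilattice.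
Variables (Y : topologicalType) (meet : Y -> Y -> Y).
Hypothesis hY : directed_deflationary_semilattice meet.

Lemma ddsl_anti (x y : Y) : spec_le x y -> spec_le y x -> x = y.
Proof. by case: hY => /directed_spaceP[anti _] _ _ _ _; exact: anti. Qed.

Lemma ddsl_meet_mono (x x' y y' : Y) :
  spec_le x x' -> spec_le y y' -> spec_le (meet x y) (meet x' y').
Proof.
case: hY => _ cm _ _ _ xx' yy'; apply/spec_leP => U oU Um.
have /(@dprod_open_up _ _ _ (x, y) (x', y')) : dprod_open
    ((fun p : dprod Y Y => meet p.1 p.2) @^-1` U).
  by rewrite -open_dprodE; exact: continuous_open.
by apply.
Qed.

Lemma ddsl_le_meet (z x y : Y) :
  spec_le z (meet x y) <-> spec_le z x /\ spec_le z y.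
Proof.
have [_ _ [idem _] comm defl] := hY.
split=> [zxy|[zx zy]].
  split; first exact: spec_le_trans zxy (defl x y).
  by apply: spec_le_trans zxy _; rewrite comm.
by rewrite -[z]idem; exact: ddsl_meet_mono.
Qed.

(** Convergence of [D] to [z] moves [meet z z = z] into any neighbourhood of
    [z] by replacing only one of the two copies of [z]. *)
Lemma ddsl_dcvg_meet (D : set Y) z V :
  directed_set (@spec_le Y) D -> dcvg D z -> open V -> V z ->
  exists2 d, D d & V (meet d z).
Proof.
have [_ cm [idem _] _ _] := hY.
move=> dirD Dz oV Vz.
have oW : dprod_open ((fun p : dprod Y Y => meet p.1 p.2) @^-1` V).
  by rewrite -open_dprodE; exact: continuous_open.
have [||||p [/= Vp [d Dd dE]]] := oW [set ((d, z) : dprod Y Y) | d in D] z z.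
- apply: directed_set_image dirD => [p q r [pq1 pq2] [qr1 qr2]|d e de].
    by split; [exact: spec_le_trans pq1 qr1|exact: spec_le_trans pq2 qr2].
  by split=> //; exact: spec_le_refl.
- by rewrite /= idem.
- apply/dcvgP => U oU Uz.
  have [d Dd Ud] := (dcvgP _ _).1 Dz U oU Uz.
  by exists d => //; exists (d, z) => //; exists d.
- apply/dcvgP => U oU Uz; have [d Dd] := dirD.1.
  by exists z => //; exists (d, z) => //; exists d.
by exists d => //; move: Vp; rewrite -dE.
Qed.

(** Meets of a finite family of elements of directed sets that all converge to
    [m] come arbitrarily close to [m]: this replaces, one at a time, the factors
    of [m = m /\ ... /\ m]. *)
Lemma ddsl_dcvg_lower_bound (I : finType) (D : I -> set Y) m V :
  (forall i, directed_set (@spec_le Y) (D i)) -> (forall i, dcvg (D i) m) ->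
  open V -> V m ->
  exists2 z, V z & forall i, exists2 d, D i d & spec_le z d.
Proof.
move=> dirD Dm oV Vm.
suff [z [Vz _ zD]] : exists z, [/\ V z, spec_le z m &
    forall i, i \in enum I -> exists2 d, D i d & spec_le z d].
  by exists z => // i; apply: zD; rewrite mem_enum.
elim: (enum I) => [|j s [z [Vz zm zD]]].
  by exists m; split=> //; exact: spec_le_refl.
have [e De Vez] := ddsl_dcvg_meet (dirD j) (dcvg_le zm (Dm j)) oV Vz.
have [eze ezz] := (ddsl_le_meet _ _ _).1 (@spec_le_refl _ (meet e z)).
exists (meet e z); split=> //; first exact: spec_le_trans ezz zm.
move=> i; rewrite inE => /orP[/eqP->|/zD[d Dd zd]]; first by exists e.
by exists d => //; exact: spec_le_trans ezz zd.
Qed.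

End DeflationarySemilattice.

(** * The space of finitely generated upper sets *)

Section UpperSpaceTheory.
Variable X : topologicalType.
Local Notation UX := (upper_space X).
Implicit Types A B : UX.

Lemma upper_carrier_inj A B : upper_carrier A = upper_carrier B -> A = B.
Proof.
case: A B => [a pa] [b pb]; rewrite /upper_carrier /= => ab.
by case: b / ab pb => pb; congr exist; exact: bool_irrelevance.
Qed.

Definition upper_of (F : set X) (hF : nonempty_finite F) : UX :=
  exist _ (up_set F) (mem_set (ex_intro2 _ _ F hF erefl)).

Lemma nonempty_finite1 (x : X) : nonempty_finite [set x].
Proof. by split; [exact: finite_set1|exists x]. Qed.

Definition upper_point (x : X) : UX := upper_of (nonempty_finite1 x).

Lemma upper_pointE x y : upper_carrier (upper_point x) y <-> spec_le x y.
Proof. by split=> [[_ ->]|xy] //; exists x. Qed.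

Lemma upper_carrierP A :
  exists2 F, nonempty_finite F & upper_carrier A = up_set F.
Proof. by have [F ? ?] := set_mem (valP A); exists F. Qed.

Lemma upper_carrier_up A x y :
  spec_le x y -> upper_carrier A x -> upper_carrier A y.
Proof.
have [F _ ->] := upper_carrierP A.
by move=> xy [a Fa ax]; exists a => //; exact: spec_le_trans ax xy.
Qed.

(** The space is generated by points under binary unions; properties of, and
    constructions on, all of its elements follow this induction. *)
Lemma upper_space_ind (P : UX -> Prop) :
  (forall x, P (upper_point x)) ->
  (forall A B, P A -> P B -> P (upper_union X A B)) ->
  forall A, P A.
Proof.
move=> Ppt PU A; have [F [/finite_seqP[s ->] [x0]]] := upper_carrierP A.
case: s => // x s _ {x0}; elim: s x A => [|y s IHs] x A FA.
  suff -> : A = upper_point x by [].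
  apply: upper_carrier_inj; rewrite FA; congr up_set.
  by apply/seteqP; split=> z /=; rewrite inE => /eqP.
have fys : nonempty_finite [set` y :: s].
  by split; [exact: finite_seq|exists y; exact: mem_head].
suff -> : A = upper_union X (upper_point x) (upper_of fys).
  by apply: PU => //; exact: IHs.
apply: upper_carrier_inj; rewrite FA /upper_carrier /= -up_setU; congr up_set.
apply/seteqP; split=> z /=.
  by rewrite inE => /orP[/eqP|]; [left|right].
by move=> [->|zs]; rewrite inE ?eqxx // zs orbT.
Qed.

(** Any finite index set may serve in place of an initial segment of the natural
    numbers, so that adding one directed set to a witness is an option type. *)
Lemma upper_cvg_fin (I : finType) (D : I -> set X) (FF : set UX) (F : set X) :
  (forall i, directed_set (@spec_le X) (D i)) ->
  (forall i, (F `&` dlim (D i)) !=set0) ->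
  F `<=` \bigcup_i dlim (D i) ->
  (forall d : I -> X, (forall i, D i (d i)) ->
     exists2 A, FF A & upper_carrier A `<=` \bigcup_i up_set [set d i]) ->
  upper_cvg FF F.
Proof.
move=> dirD FD FcD FFD; exists #|I|, (fun k => D (enum_val k)); split=> //.
  by move=> x /FcD[i _ Dx]; exists (enum_rank i) => //=; rewrite enum_rankK.
move=> d Dd; have [|A FFA Ad] := FFD (fun i => d (enum_rank i)).
  by move=> i; rewrite -[i in D i]enum_rankK.
by exists A => // x /Ad[i _ dx]; exists (enum_rank i).
Qed.

(** These open sets are what separates the elements of the space: taking for
    [U] the complement of the closure of a point shows that the specialization
    order implies reverse inclusion. *)
Lemma open_upper_box (U : set X) : open U ->
  open [set A : UX | upper_carrier A `<=` U].
Proof.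
move=> oU; rewrite open_upperE => FF F A _ _ FA [n [D [_ FD _ FFD]]] /= AU.
have Dd i : exists d, D i d /\ U d.
  have [x [Fx /dcvgP Dx]] := FD i.
  have [|d Dd Ud] := Dx U oU; last by exists d.
  by apply: AU; rewrite FA; exists x => //; exact: spec_le_refl.
have [d dP] := choice Dd.
have [B FFB Bd] := FFD d (fun i => (dP i).1).
exists B; split=> // x /Bd[i _ [_ ->]] /spec_leP/(_ U oU); apply.
exact: (dP i).2.
Qed.

Lemma spec_le_upper A B : spec_le A B <-> upper_le A B.
Proof.
split=> [/spec_leP AB y By|AB]; last first.
  by apply/spec_leP => UU oU UA; exact: upper_open_up oU UA AB.
apply: contrapT => nAy.
have /AB : open [set C : UX | upper_carrier C `<=` ~` closure [set y]].
  by apply: open_upper_box; apply: closed_openC; exact: closed_closure.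
have Ay : upper_carrier A `<=` ~` closure [set y].
  by move=> x Ax xy; apply: nAy; exact: upper_carrier_up xy Ax.
by move=> /(_ Ay y By); apply; exact: spec_le_refl.
Qed.

Lemma upper_le_trans A B C : upper_le A B -> upper_le B C -> upper_le A C.
Proof. by move=> AB BC; exact: subset_trans BC AB. Qed.

(** The topology is defined by declaring which directed families converge to
    which elements, and these families do converge topologically; a set that is
    open for topological convergence is therefore open. *)
Lemma upper_directed_space : directed_space UX.
Proof.
apply/directed_spaceP; split.
  move=> A B /spec_le_upper AB /spec_le_upper BA.
  by apply: upper_carrier_inj; apply/seteqP; split.
move=> UU dU; rewrite open_upperE => FF F A dirFF fF FA cvF UA.
have dirFF' : directed_set (@spec_le UX) FF.
  suff -> : @spec_le UX = @upper_le X by [].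
  by apply/funext => B; apply/funext => C; apply/propext; exact: spec_le_upper.
apply: (dU FF A dirFF' UA); apply/dcvgP => VV oV VA.
by have [B [? ?]] := oV FF F A dirFF fF FA cvF VA; exists B.
Qed.

Lemma upper_unionC : commutative (upper_union X).
Proof. by move=> A B; apply: upper_carrier_inj; exact: setUC. Qed.

Lemma upper_unionA : associative (upper_union X).
Proof. by move=> A B C; apply: upper_carrier_inj; exact: setUA. Qed.

Lemma upper_unionI : idempotent_op (upper_union X).
Proof. by move=> A; apply: upper_carrier_inj; exact: setUid. Qed.

(** If [D_1, ..., D_n] witness that a family converges to [F], then together
    with the constant directed set [{x}] they witness that adding [x] to its
    members gives a family converging to [F] with [x] added. *)
Lemma continuous_upper_union_point (x : X) :
  continuous (fun A => upper_union X A (upper_point x)).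
Proof.
apply/continuousP => UU oU; rewrite open_upperE.
move=> FF F A dirFF [finF F0] FA [n [D [dirD FD FcD FFD]]] /= UAx.
pose g B := upper_union X B (upper_point x).
suff [_ [[B FFB <-] UB]] : ([set g B | B in FF] `&` UU) !=set0.
  by exists B.
apply: (oU _ (F `|` [set x]) (g A)) => //.
- apply: directed_set_image dirFF => [|B C BC]; first exact: upper_le_trans.
  by move=> y [By|xy]; [left; exact: BC|right].
- by split; [rewrite finite_setU; split=> //|exists x; right].
- by rewrite /g /upper_carrier /= -/(upper_carrier A) FA up_setU.
have xx : dlim [set x] x by apply: dcvg_set1; exact: spec_le_refl.
apply: (@upper_cvg_fin (option 'I_n) (oapp D [set x])).
- by case=> [i|] //=; apply: directed_set1; exact: spec_le_refl.
- case=> [i|] /=; last by exists x; split; [right|].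
  by have [y [Fy Dy]] := FD i; exists y; split; [left|].
- by move=> y [/FcD[i _ Dy]|->]; [exists (Some i)|exists None].
- move=> d dD; have [|B FFB Bd] := FFD (fun i => d (Some i)).
    by move=> i; exact: (dD (Some i)).
  exists (g B); first by exists B.
  move=> y [/Bd[i _ dy]|xy]; first by exists (Some i).
  by exists None => //=; rewrite (dD None).
Qed.

Lemma continuous_upper_union B : continuous (fun A => upper_union X A B).
Proof.
elim/upper_space_ind: B => [x|B C cB cC].
  exact: continuous_upper_union_point.
have -> : (fun A => upper_union X A (upper_union X B C)) =
    (fun A => upper_union X A C) \o (fun A => upper_union X A B).
  by apply/funext => A /=; exact: upper_unionA.
apply/continuousP => UU oU.
exact: continuous_open cB (continuous_open cC oU).
Qed.

Lemma upper_union_ddsl : directed_deflationary_semilattice (upper_union X).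
Proof.
split.
- exact: upper_directed_space.
- apply: continuous_dprod; first exact: continuous_upper_union.
  move=> A; rewrite (_ : upper_union X A = fun B => upper_union X B A).
    exact: continuous_upper_union.
  by apply/funext => B; exact: upper_unionC.
- by split; [exact: upper_unionI|exact: upper_unionA].
- exact: upper_unionC.
- by move=> A B; apply/spec_le_upper => x; left.
Qed.

Lemma continuous_upper_point : directed_space X -> continuous upper_point.
Proof.
move=> /directed_spaceP[_ dO]; apply/continuousP => UU oU.
apply: dO => D x dirD /= Ux Dx.
suff [_ [[d Dd <-] Ud]] : ([set upper_point d | d in D] `&` UU) !=set0.
  by exists d.
apply: (oU _ [set x] (upper_point x)) => //.
- apply: directed_set_image dirD => [|d e de]; first exact: upper_le_trans.
  by move=> y /upper_pointE ey; apply/upper_pointE; exact: spec_le_trans de ey.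
- exact: nonempty_finite1.
apply: (@upper_cvg_fin unit (fun=> D)) => //.
- by move=> _; exists x.
- by move=> _ ->; exists tt.
move=> d Dd; exists (upper_point (d tt)); first by exists (d tt).
by move=> y dy; exists tt.
Qed.

End UpperSpaceTheory.

(** * The universal property *)

Section Extension.
Variables (X Y : topologicalType) (meet : Y -> Y -> Y).
Hypothesis hY : directed_deflationary_semilattice meet.
Variable f : X -> Y.
Hypothesis cf : continuous f.
Local Notation UX := (upper_space X).

(** An infimum over the whole upper set, rather than a meet over a generating
    set, makes the value independent of the generators. *)
Definition upper_inf (A : UX) (y : Y) : Prop :=
  forall z, spec_le z y <-> forall x, upper_carrier A x -> spec_le z (f x).

Lemma upper_inf_uniq A y y' : upper_inf A y -> upper_inf A y' -> y = y'.
Proof.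
move=> Ay Ay'; apply: (ddsl_anti hY).
  by apply/Ay'/Ay; exact: spec_le_refl.
by apply/Ay/Ay'; exact: spec_le_refl.
Qed.

Lemma upper_inf_point x : upper_inf (upper_point x) (f x).
Proof.
move=> z; split=> [zx y /upper_pointE xy|]; last first.
  by apply; apply/upper_pointE; exact: spec_le_refl.
exact: spec_le_trans zx (continuous_spec_le cf xy).
Qed.

Lemma upper_inf_union A B y z :
  upper_inf A y -> upper_inf B z -> upper_inf (upper_union X A B) (meet y z).
Proof.
move=> Ay Bz w; split=> [/(ddsl_le_meet hY)[/Ay wA /Bz wB] x [/wA|/wB]//|wAB].
by apply/(ddsl_le_meet hY); split; [apply/Ay|apply/Bz] => x ?; apply: wAB;
  [left|right].
Qed.

Lemma upper_inf_exists A : exists y, upper_inf A y.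
Proof.
elim/upper_space_ind: A => [x|A B [y Ay] [z Bz]].
  by exists (f x); exact: upper_inf_point.
by exists (meet y z); exact: upper_inf_union.
Qed.

(** Suppose that [FF] converges to [F] through [D_1, ..., D_n]. Each [D_i] has a
    limit in [F], so [f D_i] converges to the infimum [m] of [f F], which lies
    below the image of that limit. Some [d_i] in [D_i] then have a common lower
    bound of the [f d_i] close to [m], and some member of [FF] is contained in
    the upper set that these [d_i] generate. *)
Lemma continuous_upper_inf (h : UX -> Y) :
  (forall A, upper_inf A (h A)) -> continuous h.
Proof.
move=> hP; apply/continuousP => V oV; rewrite open_upperE.
move=> FF F A _ _ FA [n [D [dirD FD _ FFD]]] /= VA.
have fDm i : dcvg [set f d | d in D i] (h A).
  have [x [Fx Dx]] := FD i; apply: dcvg_le (continuous_dcvg cf Dx).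
  apply: (hP A _).1 (@spec_le_refl _ _) _ _.
  by rewrite FA; exists x => //; exact: spec_le_refl.
have [|z Vz zD] := ddsl_dcvg_lower_bound hY _ fDm oV VA.
  move=> i; apply: directed_set_image (dirD i); first exact: spec_le_trans.
  exact: continuous_spec_le.
have /choice[d dP] i : exists d, D i d /\ spec_le z (f d).
  by have [_ [d Dd <-] zd] := zD i; exists d.
have [B FFB Bd] := FFD d (fun i => (dP i).1).
exists B; split=> //=.
have /spec_leP : spec_le z (h B); last by apply.
apply/(hP B) => x /Bd[i _ [_ -> dx]].
exact: spec_le_trans (dP i).2 (continuous_spec_le cf dx).
Qed.

(** Existence is given by infima, uniqueness by induction on the generation of
    the upper set by points. *)
Lemma upper_extension_uniq :
  exists! fbar : UX -> Y,
    deflationary_hom (upper_union X) meet fbar /\ f = fbar \o @upper_point X.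
Proof.
have [h hP] := choice upper_inf_exists.
exists h; split.
  split; last first.
    apply/funext => x /=.
    exact: upper_inf_uniq (upper_inf_point x) (hP (upper_point x)).
  split; first exact: continuous_upper_inf.
  by move=> A B; exact: upper_inf_uniq (hP _) (upper_inf_union (hP A) (hP B)).
move=> g [[_ gU] fg]; apply/funext => A.
suff : upper_inf A (g A) by exact: upper_inf_uniq.
elim/upper_space_ind: A => [x|A B Ag Bg].
  by rewrite -[g _]/((g \o @upper_point X) x) -fg; exact: upper_inf_point.
by rewrite gU; exact: upper_inf_union.
Qed.

End Extension.

Lemma upper_powerspace (X : topologicalType) :
  directed_space X -> directed_upper_powerspace X (upper_union X).
Proof.
move=> hX; split; first exact: upper_union_ddsl.
exists (@upper_point X); first exact: continuous_upper_point.
by move=> Y meet hY f cf; exact: upper_extension_uniq.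
Qed.

(** * Uniqueness of the powerspace *)

Lemma deflationary_hom_id (X : topologicalType) (op : X -> X -> X) :
  deflationary_hom op op id.
Proof. by split=> //; apply/continuousP. Qed.

Lemma deflationary_hom_comp (X Y Z : topologicalType) (opX : X -> X -> X)
    (opY : Y -> Y -> Y) (opZ : Z -> Z -> Z) (f : X -> Y) (g : Y -> Z) :
  deflationary_hom opX opY f -> deflationary_hom opY opZ g ->
  deflationary_hom opX opZ (g \o f).
Proof.
move=> [/continuousP cf fM] [/continuousP cg gM]; split.
  by apply/continuousP => U oU; exact: cf (cg _ oU).
by move=> x y /=; rewrite fM gM.
Qed.

(** The two extensions of the unit maps along each other are mutually inverse,
    because each composite and the identity both extend the same unit map. *)
Lemma directed_upper_powerspace_uniq (X Z Z' : topologicalType)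
    (meet : Z -> Z -> Z) (meet' : Z' -> Z' -> Z') :
  directed_upper_powerspace X meet -> directed_upper_powerspace X meet' ->
  deflationary_iso meet meet'.
Proof.
move=> [hZ [i ci univ]] [hZ' [i' ci' univ']].
have [f [[hf fi] _]] := univ _ _ hZ' _ ci'.
have [g [[hg gi] _]] := univ' _ _ hZ _ ci.
have gf : g \o f = id.
  have [h [_ uniq]] := univ _ _ hZ _ ci.
  rewrite -(uniq (g \o f)); last first.
    by split; [exact: deflationary_hom_comp hf hg|rewrite -compA -fi].
  by apply: uniq; split; first exact: deflationary_hom_id.
have fg : f \o g = id.
  have [h [_ uniq]] := univ' _ _ hZ' _ ci'.
  rewrite -(uniq (f \o g)); last first.
    by split; [exact: deflationary_hom_comp hg hf|rewrite -compA -gi].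
  by apply: uniq; split; first exact: deflationary_hom_id.
exists f, g; split=> //.
- by move=> z; exact: (congr1 (@^~ z) gf).
- by move=> z; exact: (congr1 (@^~ z) fg).
- exact: hg.1.
Qed.

Theorem theorem5p9 (X : topologicalType) (hX : directed_space X) :
  directed_upper_powerspace X (upper_union X) /\
  (forall (Z : topologicalType) (meetZ : Z -> Z -> Z),
     directed_upper_powerspace X meetZ ->
     deflationary_iso (upper_union X) meetZ).
Proof.
split; first exact: upper_powerspace.
move=> Z meetZ; apply: directed_upper_powerspace_uniq.
exact: upper_powerspace.
Qed.
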